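(* Let $X$ be a graph, and let $X'$ be the graph obtained by contracting all the bridges in $X$. Then $$\zeta(t,u,X)=\zeta(t,u,X').$$
   Context: Throughout, ''graph'' means an undirected, connected, finite multigraph without loops. For a graph $X$, $V(X)$ is its vertex set. A bridge is an edge whose removal disconnects the graph. For an ordering $v_1,\dots,v_n$ of $V(X)$, the Laplacian matrix is $L_X=D_X-A_X$, where $D_X$ is the diagonal matrix of vertex degrees and $A_X$ is the adjacency matrix (counting edges with multiplicity). $\mathrm{Div}(X)$ is the free abelian group on $V(X)$; its elements are called divisors. The degree of $D=\sum a_iv_i$ is $\deg(D)=\sum a_i$. $D$ is effective if all $a_i\ge 0$; $\mathrm{Div}_+(X)$ is the set of effective divisors. The Picard group is $\mathrm{Pic}(X)=\mathrm{Div}(X)/\mathrm{im}(L_X)$, where $\mathrm{im}(L_X)$ is the image of $L_X$ as a $\mathbb{Z}$-endomorphism of $\mathrm{Div}(X)$; the degree is well defined on it. Write $D\sim D'$ if $D,D'$ have the same class, and $|D|$ for the set of effective divisors equivalent to $D$. The Riemann--Roch structure is $h(D)=\min\{\deg(E): E\in\mathrm{Div}_+(X),\ |D-E|=\emptyset\}$. It depends only on the class of $D$, so $h$ is a function on $\mathrm{Pic}(X)$ with values in $\{0,1,2,\dots\}$. The two-variable Lorenzini zeta function of $X$ is the formal power series in $t$ with coefficients in $\mathbb{Z}[u]$ $$\zeta(t,u,X)=\sum_{D\in\mathrm{Pic}(X)}\frac{u^{h(D)}-1}{u-1}\,t^{\deg(D)},$$ where $\frac{u^m-1}{u-1}=1+u+\dots+u^{m-1}$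 (equal to $0$ when $m=0$). *)

(* Defs.v *)
From HB Require Import structures.
From mathcomp Require Import all_boot all_order all_algebra.
From mathcomp Require Import generic_quotient ring_quotient.

Set Implicit Arguments.
Unset Strict Implicit.
Unset Printing Implicit Defensive.

Import Order.TTheory GRing.Theory Num.Theory.
Local Open Scope ring_scope.
Local Open Scope quotient_scope.

Definition adj (V E : finType) (ends : E -> {set V}) (F : {set E}) : rel V :=
  fun x y => [exists e in F, ends e == [set x; y]].

Definition connected_via (V E : finType) (ends : E -> {set V}) (F : {set E}) :
    bool :=
  [forall x, forall y, connect (adj ends F) x y].

(* Loops are excluded by [ends_card]; parallel edges are distinct elements of
   [edge] with the same ends. *)
Record graph := Graph {
  vertex : finType;
  edge : finType;
  ends : edge -> {set vertex};
  ends_card : forall e, #|ends e| = 2%N;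
  vertex_gt0 : (0 < #|vertex|)%N;
  graph_connected : connected_via ends [set: edge] }.

Definition bridge (X : graph) (e : edge X) : bool :=
  ~~ connected_via (@ends X) (~: [set e]).

Definition bridges (X : graph) : {set edge X} := [set e | bridge e].

Lemma adj_sym (V E : finType) (ends : E -> {set V}) (F : {set E}) :
  symmetric (adj ends F).
Proof. by move=> x y; apply: eq_existsb => e; rewrite setUC. Qed.

Lemma connect_adj_sym (V E : finType) (ends : E -> {set V}) (F : {set E}) :
  connect_sym (adj ends F).
Proof. by apply: sym_connect_sym; apply: adj_sym. Qed.

Lemma sub_connect_adj (V E : finType) (ends : E -> {set V}) (F G : {set E}) :
  F \subset G -> subrel (connect (adj ends F)) (connect (adj ends G)).
Proof.
move=> sFG; apply: connect_sub => x y /exists_inP[e eF ee].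
by apply: connect1; apply/exists_inP; exists e => //; apply: (subsetP sFG).
Qed.

Lemma connect_adj_del (V E : finType) (ends : E -> {set V}) (F : {set E})
    (b : E) (p q x y : V) :
  ends b = [set p; q] -> connect (adj ends F) x y ->
  let R := connect (adj ends (F :\ b)) in
  [\/ R x y, R x p /\ R q y | R x q /\ R p y].
Proof.
move=> eb /connectP[s]; elim: s x => [|z s IH] x /=.
  by move=> _ ->; apply: Or31; apply: connect0.
case/andP=> /exists_inP[e eF /eqP ee] zs ey.
have [ebE|neb] := eqVneq e b; last first.
  have xz : connect (adj ends (F :\ b)) x z.
    apply: connect1; apply/exists_inP; exists e; last by rewrite ee.
    by rewrite !inE neb.
  case: (IH z zs ey) => [zy|[zp qy]|[zq py]].
  - by apply: Or31; apply: connect_trans zy.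
  - by apply: Or32; split=> //; apply: connect_trans zp.
  - by apply: Or33; split=> //; apply: connect_trans zq.
have pR (u : V) : connect (adj ends (F :\ b)) u u by apply: connect0.
have pq : [set x; z] = [set p; q] by rewrite -ee ebE eb.
have hx : x \in [set p; q] by rewrite -pq !inE eqxx.
have hz : z \in [set p; q] by rewrite -pq !inE eqxx orbT.
have hp : p \in [set x; z] by rewrite pq !inE eqxx.
have hq : q \in [set x; z] by rewrite pq !inE eqxx orbT.
have [xzE|xz] := eqVneq x z; first by subst z; apply: IH.
have : (x = p /\ z = q) \/ (x = q /\ z = p).
  move: hx hz; rewrite !inE => /orP[] /eqP xE /orP[] /eqP zE; subst x z.
  - by rewrite eqxx in xz.
  - by left.
  - by right.
  - by rewrite eqxx in xz.
case=> -[? ?]; subst x z.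
- case: (IH q zs ey) => [qy|[qp qy]|[_ py]].
  + by apply: Or32.
  + by apply: Or32.
  + by apply: Or31.
- case: (IH p zs ey) => [py|[_ qy]|[pq' py]].
  + by apply: Or33.
  + by apply: Or31.
  + by apply: Or33.
Qed.

Lemma bridge_cut (X : graph) (b : edge X) (p q : vertex X) :
  bridge b -> ends b = [set p; q] ->
  ~~ connect (adj (@ends X) (~: [set b])) p q.
Proof.
move=> bb eb; apply: contra bb => pq; apply/forallP=> x; apply/forallP=> y.
have := graph_connected X => /forallP/(_ x)/forallP/(_ y).
move=> /(connect_adj_del eb); rewrite setTD => -[//|[xp qy]|[xq py]].
- by apply: connect_trans xp (connect_trans pq qy).
- by apply: connect_trans xq (connect_trans _ py); rewrite connect_adj_sym.
Qed.

Lemma non_bridge_ends (X : graph) (e : edge X) (x y : vertex X) :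
  ~~ bridge e -> ends e = [set x; y] ->
  connect (adj (@ends X) (bridges X)) x y -> x = y.
Proof.
move=> nbe ee; suff H (S : {set edge X}) :
    S \subset bridges X -> connect (adj (@ends X) S) x y -> x = y by apply: H.
have [n] := ubnP #|S|.
elim: n S => // n IH S leSn sS cxy.
have [S0|[b bS]] := set_0Vmem S.
  case/connectP: cxy => s; case: s => [_ -> //|z s /= /andP[/exists_inP[f]]].
  by rewrite S0 inE.
have bb : bridge b by have := subsetP sS _ bS; rewrite inE.
have neb : e != b by apply: contraNneq nbe => ->.
have /cards2P[p [q [_ eb]]] : #|ends b| == 2 by rewrite ends_card.
have sub : S :\ b \subset ~: [set b] by rewrite setDE subsetIr.
have xy : connect (adj (@ends X) (~: [set b])) x y.
  by apply: connect1; apply/exists_inP; exists e; rewrite ?inE ?ee.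
have yx := xy; rewrite connect_adj_sym in yx.
case: (connect_adj_del eb cxy) => [|[xp qy]|[xq py]].
- apply: IH; last by apply: subset_trans sS; apply: subsetDl.
  by rewrite -ltnS (leq_trans _ leSn) // ltnS [leqRHS](cardsD1 b) bS.
- case/negP: (bridge_cut bb eb).
  have := sub_connect_adj sub xp; have := sub_connect_adj sub qy.
  rewrite connect_adj_sym => yq; rewrite connect_adj_sym => px.
  by apply: connect_trans px (connect_trans xy yq).
- case/negP: (bridge_cut bb eb).
  have := sub_connect_adj sub xq; have := sub_connect_adj sub py => py' xq'.
  by apply: connect_trans py' (connect_trans yx xq').
Qed.

Definition bridge_block (X : graph) (x : vertex X) : {set vertex X} :=
  [set y | connect (adj (@ends X) (bridges X)) x y].

Definition contract_vertex (X : graph) : finType :=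
  {B : {set vertex X} | B \in [set bridge_block x | x : vertex X]}.

Definition contract_edge (X : graph) : finType := {e : edge X | ~~ bridge e}.

Definition contract_map (X : graph) (x : vertex X) : contract_vertex X :=
  exist _ (bridge_block x) (imset_f _ (erefl true)).

Definition contract_ends (X : graph) (e : contract_edge X) :
    {set contract_vertex X} :=
  [set contract_map x | x in ends (val e)].

Lemma contract_mapP (X : graph) (x y : vertex X) :
  reflect (contract_map x = contract_map y)
          (connect (adj (@ends X) (bridges X)) x y).
Proof.
apply: (iffP idP) => [xy|/(congr1 val) /= /setP/(_ y)].
  apply: val_inj; apply/setP=> z; rewrite !inE.
  exact: (same_connect (@connect_adj_sym _ _ _ _)).
by rewrite !inE connect0 => ->.
Qed.

Lemma contract_map_surj (X : graph) (B : contract_vertex X) :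
  exists x, B = contract_map x.
Proof.
by case: B => B hB; case/imsetP: (hB) => x _ E; exists x; apply: val_inj.
Qed.

Lemma contract_ends_card (X : graph) (e : contract_edge X) :
  #|contract_ends e| = 2%N.
Proof.
case: e => e nbe; rewrite /contract_ends /=.
have /cards2P[x [y [xy ee]]] : #|ends e| == 2%N by rewrite ends_card.
rewrite ee imsetU1 imset_set1 cards2.
suff -> : contract_map x != contract_map y by [].
by apply: contraNneq xy => /contract_mapP/(non_bridge_ends nbe ee) ->.
Qed.

Lemma contract_vertex_gt0 (X : graph) : (0 < #|contract_vertex X|)%N.
Proof.
have /card_gt0P[x _] := vertex_gt0 X.
by apply/card_gt0P; exists (contract_map x).
Qed.

Lemma contract_connected (X : graph) :
  connected_via (@contract_ends X) [set: contract_edge X].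
Proof.
apply/forallP=> B; apply/forallP=> C.
have [x ->] := contract_map_surj B; have [y ->] := contract_map_surj C.
have := graph_connected X => /forallP/(_ x)/forallP/(_ y) /connectP[s].
elim: s x => [|z s IH] x /=; first by move=> _ ->; apply: connect0.
case/andP=> /exists_inP[e _ /eqP ee] zs ey.
apply: connect_trans (IH z zs ey).
have [be|nbe] := boolP (bridge e).
  suff -> : contract_map x = contract_map z by apply: connect0.
  apply/contract_mapP/connect1/exists_inP; exists e; first by rewrite inE.
  by rewrite ee.
apply/connect1/exists_inP; exists (exist _ e nbe : contract_edge X) => //.
by rewrite /contract_ends /= ee imsetU1 imset_set1.
Qed.

Definition contract_bridges (X : graph) : graph :=
  @Graph (contract_vertex X) (contract_edge X) (@contract_ends X)
    (@contract_ends_card X) (contract_vertex_gt0 X) (@contract_connected X).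

Definition degree (X : graph) (v : vertex X) : nat := #|[set e | v \in ends e]|.

(* The diagonal entries vanish: no edge has the singleton [set v; v] as ends. *)
Definition adjacency (X : graph) (v w : vertex X) : nat :=
  #|[set e | ends e == [set v; w]]|.

Definition laplacian (X : graph) (v w : vertex X) : int :=
  (degree v)%:Z *+ (v == w) - (adjacency v w)%:Z.

Definition Div (X : graph) := {ffun vertex X -> int}.

Definition deg (X : graph) (D : Div X) : int := \sum_v D v.

Definition effective (X : graph) (D : Div X) : Prop := forall v, 0 <= D v.

Definition laplacian_map (X : graph) (D : Div X) : Div X :=
  [ffun v => \sum_w laplacian v w * D w].

Lemma laplacian_mapB (X : graph) : zmod_morphism (@laplacian_map X).
Proof.
move=> f g; apply/ffunP=> v; rewrite !ffunE -sumrB; apply: eq_bigr => w _.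
by rewrite !ffunE mulrBr.
Qed.

Lemma deg_laplacian_map (X : graph) (f : Div X) : deg (laplacian_map f) = 0.
Proof.
rewrite /deg; under eq_bigr do rewrite ffunE.
rewrite exchange_big /= big1 // => w _; rewrite -mulr_suml.
suff -> : \sum_v laplacian v w = 0 :> int by rewrite mul0r.
rewrite /laplacian sumrB (bigD1 w) //= eqxx big1 ?addr0 => [|v /negPf ->] //.
apply/eqP; rewrite subr_eq0 -(big_morph Posz PoszD (erefl 0)) eqz_nat.
apply/eqP.
rewrite /degree /adjacency.
transitivity (\sum_(e : edge X | w \in ends e) 1)%N.
  by rewrite sum1dep_card; apply: eq_card => e; rewrite !inE.
transitivity (\sum_(v : vertex X) \sum_(e : edge X | ends e == [set v; w]) 1)%N;
  last by apply: eq_bigr => v _; rewrite sum1dep_card.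
rewrite (exchange_big_dep (fun e : edge X => w \in ends e)) /=; last first.
  by move=> v e _ /eqP ->; rewrite !inE eqxx orbT.
apply: eq_bigr => e we; rewrite sum1dep_card.
have /cards2P[x [y [xy ee]]] : #|ends e| == 2%N by rewrite ends_card.
have [v vw ev] : exists2 v, v != w & ends e = [set v; w].
  move: we; rewrite ee !inE => /orP[] /eqP ->; last by exists x.
  by exists y; [rewrite eq_sym | rewrite setUC].
rewrite -[LHS](cards1 v); apply: eq_card => u; rewrite !inE ev.
apply/eqP/eqP => [-> //|/setP uv].
have := uv v; rewrite !inE eqxx (negPf vw) /= orbF => /esym/eqP -> //.
Qed.

Lemma deg_morph (X : graph) : zmod_morphism (@deg X).
Proof.
by move=> D D'; rewrite /deg -sumrB; apply: eq_bigr => v _; rewrite !ffunE.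
Qed.

From mathcomp Require Import finmap.
From mathcomp Require Import boolp classical_sets functions cardinality fsbigop.

Definition im_laplacian (X : graph) : {pred Div X} :=
  fun D => `[< exists f : Div X, D = laplacian_map f >].

Lemma im_laplacian_zmod_closed (X : graph) : zmod_closed (@im_laplacian X).
Proof.
split=> [|D D' /asboolP[f ->] /asboolP[g ->]]; apply/asboolP.
  exists 0; apply/ffunP=> v; rewrite !ffunE big1 // => w _.
  by rewrite ffunE mulr0.
by exists (f - g); rewrite laplacian_mapB.
Qed.

HB.instance Definition _ (X : graph) :=
  GRing.isZmodClosed.Build (Div X) (@im_laplacian X)
    (@im_laplacian_zmod_closed X).

Definition Pic (X : graph) := Quotient.quot (@im_laplacian X).

Definition div_equiv (X : graph) (D D' : Div X) : Prop :=
  \pi_(Pic X) D = \pi_(Pic X) D'.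

Lemma div_equivP (X : graph) (D D' : Div X) :
  div_equiv D D' <-> exists f, D - D' = laplacian_map f.
Proof.
split=> [/eqP|H]; first by rewrite eqmodE => /asboolP.
by apply/eqP; rewrite eqmodE; apply/asboolP.
Qed.

Lemma deg_equiv (X : graph) (D D' : Div X) : div_equiv D D' -> deg D = deg D'.
Proof.
move=> /div_equivP[f E]; apply/eqP.
by rewrite -subr_eq0 -deg_morph E deg_laplacian_map.
Qed.

Definition linear_system (X : graph) (D : Div X) : set (Div X) :=
  [set D' : Div X | effective D' /\ div_equiv D' D]%classic.

Definition kills (X : graph) (D : Div X) (k : nat) : bool :=
  `[< exists E : Div X,
      [/\ effective E, deg E = k%:Z & linear_system (D - E) = set0%classic] >].

Lemma deg_ge0 (X : graph) (D : Div X) : effective D -> 0 <= deg D.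
Proof. by move=> eD; apply: sumr_ge0 => v _; apply: eD. Qed.

Lemma linear_system_lt0 (X : graph) (D : Div X) :
  deg D < 0 -> linear_system D = set0%classic.
Proof.
move=> D0; rewrite -subset0 => D' [/deg_ge0 + /deg_equiv E].
by rewrite E leNgt D0.
Qed.

Lemma kills_ex (X : graph) (D : Div X) : exists k, kills D k.
Proof.
have /card_gt0P[x _] := vertex_gt0 X.
pose m := `|deg D|.+1; exists m; apply/asboolP.
exists [ffun v => if v == x then m%:Z else 0].
have degE : deg ([ffun v => if v == x then m%:Z else 0] : Div X) = m%:Z.
  rewrite /deg (bigD1 x) //= ffunE eqxx big1 ?addr0 // => v /negPf vx.
  by rewrite ffunE vx.
split=> //; first by move=> v; rewrite ffunE; case: ifP.
apply: linear_system_lt0; rewrite deg_morph degE subr_lt0.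
rewrite /m -addn1 PoszD abszE.
by apply: le_lt_trans (ler_norm _) _; rewrite ltrDl.
Qed.

Definition rr_h (X : graph) (D : Div X) : nat := ex_minn (kills_ex D).

Definition pic_deg (X : graph) (c : Pic X) : int := deg (repr c).

Definition pic_h (X : graph) (c : Pic X) : nat := rr_h (repr c).

Lemma rr_h_equiv (X : graph) (D D' : Div X) :
  div_equiv D D' -> rr_h D = rr_h D'.
Proof.
move=> DD'; suff E : kills D =1 kills D'.
  rewrite /rr_h; case: ex_minnP => m km mm; case: ex_minnP => n kn nn.
  by apply/eqP; rewrite eqn_leq mm ?E //= nn -?E.
have lE E : linear_system (D - E) = linear_system (D' - E).
  have e : div_equiv (D - E) (D' - E).
    apply/div_equivP; have /div_equivP[f fE] := DD'; exists f.
    by rewrite opprB addrA subrK.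
  by rewrite /linear_system /div_equiv e.
by move=> k; apply: asbool_equiv_eq; split=> -[E [E0 Ek l0]]; exists E;
  split=> //; [rewrite -lE | rewrite lE].
Qed.

Lemma pic_degE (X : graph) (D : Div X) : pic_deg (\pi_(Pic X) D) = deg D.
Proof. by apply: deg_equiv; rewrite /div_equiv reprK. Qed.

Lemma pic_hE (X : graph) (D : Div X) : pic_h (\pi_(Pic X) D) = rr_h D.
Proof. by apply: rr_h_equiv; rewrite /div_equiv reprK. Qed.

Lemma rr_h_gt0 (X : graph) (D : Div X) :
  (0 < rr_h D)%N -> exists D', linear_system D D'.
Proof.
rewrite /rr_h; case: ex_minnP => m _ mm m0; apply/set0P/eqP => l0.
suff /mm : kills D 0 by rewrite leqNgt m0.
apply/asboolP; exists 0; split; first by move=> v; rewrite ffunE.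
  by rewrite /deg big1 // => v _; rewrite ffunE.
by rewrite subr0.
Qed.

(* A formal power series in t with coefficients in R, given by its coefficient
   sequence. *)
Definition power_series (R : Type) := nat -> R.

(* (u ^ m - 1) / (u - 1), with 'X in the role of u *)
Definition u_quot (m : nat) : {poly int} := \sum_(i < m) 'X^i.

Lemma u_quotE (m : nat) : u_quot m * ('X - 1) = 'X^m - 1.
Proof. by rewrite subrX1 mulrC. Qed.

(* The next two lemmas show that collecting the powers of t makes sense: no
   negative power of t occurs, and each coefficient is a finite sum. *)
Lemma u_quot_pic_h_lt0 (X : graph) (c : Pic X) :
  pic_deg c < 0 -> u_quot (pic_h c) = 0.
Proof.
move=> c0; have [->|] := posnP (pic_h c); first by rewrite /u_quot big_ord0.
by move=> /rr_h_gt0[D]; rewrite linear_system_lt0.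
Qed.

Lemma zeta_support_finite (X : graph) (n : nat) :
  finite_set ([set c : Pic X | pic_deg c = n%:Z] `&`
              [set c | u_quot (pic_h c) != 0])%classic.
Proof.
pose F (a : {ffun vertex X -> 'I_n.+1}) : Pic X :=
  \pi_(Pic X) ([ffun v => (a v : nat)%:Z] : Div X).
apply: (@sub_finite_set _ _ (F @` setT)%classic); last first.
  by apply: finite_image; apply: finite_finset.
move=> c [/= cn c0].
have [D [eD Dc]] : exists D', linear_system (repr c) D'.
  apply: rr_h_gt0; have [E|//] := posnP (pic_h c).
  by rewrite E /u_quot big_ord0 eqxx in c0.
have Dn : deg D = n%:Z by rewrite (deg_equiv Dc).
have Db v : (`|D v| < n.+1)%N.
  rewrite ltnS -lez_nat -Dn gez0_abs ?eD // /deg (bigD1 v) //= lerDl.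
  by apply: sumr_ge0.
exists [ffun v => Ordinal (Db v)] => //.
rewrite /F -[RHS]reprK -Dc; congr (\pi_(Pic X) _).
by apply/ffunP=> v; rewrite !ffunE /= gez0_abs ?eD.
Qed.

Definition zeta (X : graph) : power_series {poly int} :=
  fun n => \sum_(c \in [set c : Pic X | pic_deg c = n%:Z]%classic)
             u_quot (pic_h c).

(* Main.v *)
Require Import Defs.
From HB Require Import structures.
From mathcomp Require Import all_boot all_order all_algebra.
From mathcomp Require Import generic_quotient ring_quotient.
From mathcomp Require Import boolp classical_sets fsbigop.

Set Implicit Arguments.
Unset Strict Implicit.
Unset Printing Implicit Defensive.

Import Order.TTheory GRing.Theory Num.Theory.
Local Open Scope ring_scope.
Local Open Scope quotient_scope.

(** Let pi : X -> X' be the contraction and let [push] send a divisor D on X to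
    the divisor on X' whose value at a block of vertices is the sum of D over
    that block. It is additive, it preserves degrees and effectiveness, and
    every (effective) divisor on X' is the image of an (effective) divisor on X
    ([effective_lift]). The heart of the proof is that D is principal if and
    only if [push D] is ([push_im_laplacian]). Then [push] induces an
    isomorphism Pic(X) -> Pic(X') of graded groups under which emptiness of
    linear systems, hence h, is preserved, and the two zeta functions are the
    same sum written over two index sets in bijection.

    Everything about principal divisors comes from the edge expansion
      L f = \sum_e (f(p_e) - f(q_e)) (p_e - q_e),
    where p_e and q_e are the ends of e ([laplacian_map_edges]).

    - If g is a function on X', the bridges do not contribute to L (g o pi),
      and the other edges are the edges of X'; so [push] maps L (g o pi) to
      L' g ([push_laplacian_pullback]).

    - For a bridge b with ends p and q, let 1_b be the indicator function of the
      side of b that contains p. It is constant across every edge but b, so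
      L 1_b = p - q ([laplacian_bridge_side]). Consequently two vertices of the
      same block are equivalent divisors, and the kernel of [push], which is
      generated by the differences of such vertices, is principal
      ([push_eq0]). Together with the first item this shows that D is principal
      when [push D] is.

    - Subtracting from an arbitrary f the function
      f0 = \sum_b (f(p_b) - f(q_b)) 1_b makes it constant along each bridge, so
      f - f0 = g o pi for some g, whereas [push] kills L f0. So [push] maps L f to
      the principal divisor L' g ([push_laplacian]). *)

(** * The Laplacian as a sum over the edges *)

Definition point (X : graph) (v : vertex X) : Div X :=
  [ffun u => (u == v)%:R].

Lemma sum_point (X : graph) (D : Div X) : D = \sum_v point v *~ D v.
Proof.
apply/ffunP=> u; rewrite sum_ffunE (bigD1 u) //= big1 => [|v vu].
  by rewrite ffunMzE ffunE eqxx addr0 intz.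
by rewrite ffunMzE ffunE eq_sym (negPf vu) mul0rz.
Qed.

HB.instance Definition _ (X : graph) :=
  GRing.isZmodMorphism.Build (Div X) (Div X) (@laplacian_map X)
    (@laplacian_mapB X).

Lemma eq_set2l (T : finType) (x y z : T) :
  x != y -> ([set x; y] == [set x; z]) = (z == y).
Proof.
move=> xy; apply/eqP/eqP=> [/setP/(_ y)|-> //].
by rewrite !inE eqxx orbT eq_sym (negPf xy) => /esym/eqP.
Qed.

(** Each edge {v, w} at v contributes f(v) - f(w) to the value of L f at v. The
    orientation [p, q] is arbitrary since reversing an edge changes the sign of
    both factors of its term; this freedom lets the same orientation be used on
    a graph and on its contraction, and lets the ends of one chosen edge be
    named at will. *)
Lemma laplacian_map_edges (X : graph) (p q : edge X -> vertex X) (f : Div X) :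
  (forall e, ends e = [set p e; q e]) ->
  laplacian_map f =
    \sum_e (point (p e) - point (q e)) *~ (f (p e) - f (q e)).
Proof.
move=> pqE; have pq e : p e != q e.
  by have := ends_card e; rewrite pqE cards2; case: eqP.
apply/ffunP=> v; rewrite ffunE sum_ffunE.
transitivity (\sum_e (f v *+ (v \in ends e)
                      - \sum_w f w *+ (ends e == [set v; w]))).
  rewrite sumrB exchange_big /= sumrMnr.
  under eq_bigr do rewrite mulrBl; rewrite sumrB; congr (_ - _).
    rewrite (bigD1 v) //= eqxx mulr1n big1 ?addr0 => [|w wv]; last first.
      by rewrite eq_sym (negPf wv) mul0r.
    rewrite mulrC -natz mulr_natr; congr (_ *+ _).
    by rewrite /degree -sum1dep_card big_mkcond.
  apply: eq_bigr => w _; rewrite /= sumrMnr mulrC -natz mulr_natr.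
  congr (_ *+ _).
  by rewrite /adjacency -sum1dep_card big_mkcond.
apply: eq_bigr => e _; rewrite ffunMzE !ffunE pqE !inE.
have [->|vp] := eqVneq v (p e).
  rewrite (negPf (pq e)) subr0 intz mulr1n; congr (_ - _).
  rewrite (bigD1 (q e)) //= eqxx big1 ?addr0 // => w wq.
  by rewrite eq_set2l // (negPf wq).
have [->|vq] := eqVneq v (q e).
  rewrite sub0r mulNrz intz opprB mulr1n; congr (_ - _).
  rewrite (bigD1 (p e)) //= finset.setUC eqxx big1 ?addr0 // => w wp.
  by rewrite eq_set2l ?(negPf wp) // eq_sym.
rewrite subr0 mul0rz mulr0n big1 ?subr0 // => w _.
case: eqP => // /setP/(_ v).
by rewrite !inE eqxx (negPf vp) (negPf vq).
Qed.

Lemma edge_orientation (X : graph) :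
  exists pq : (edge X -> vertex X) * (edge X -> vertex X),
    forall e, ends e = [set pq.1 e; pq.2 e].
Proof.
have /choice[g gE] (e : edge X) :
    exists xy : vertex X * vertex X, ends e = [set xy.1; xy.2].
  have /cards2P[x [y [_ ->]]] : #|ends e| == 2%N by rewrite ends_card.
  by exists (x, y).
by exists (fst \o g, snd \o g).
Qed.

(** * Bridges give equivalences between vertices *)

Definition bridge_side (X : graph) (b : edge X) (p : vertex X) : Div X :=
  [ffun v => (connect (adj (@ends X) (~: [set b])) p v)%:R].

Lemma bridge_side_ends (X : graph) (b e : edge X) (p x y : vertex X) :
  e != b -> ends e = [set x; y] -> bridge_side b p x = bridge_side b p y.
Proof.
move=> eb exy; rewrite !ffunE; congr (nat_of_bool _)%:R.
apply: (same_connect_r (@connect_adj_sym _ _ _ _)).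
by apply: connect1; apply/exists_inP; exists e; rewrite ?inE // exy.
Qed.

Lemma bridge_side_diff (X : graph) (b : edge X) (p q : vertex X) :
  bridge b -> ends b = [set p; q] -> bridge_side b p p - bridge_side b p q = 1.
Proof.
move=> bb bpq; rewrite !ffunE connect0.
by rewrite (negPf (bridge_cut bb bpq)) subr0.
Qed.

(** In the edge expansion only the term of [b] survives, because a side of [b]
    can be left through [b] alone. *)
Lemma laplacian_bridge_side (X : graph) (b : edge X) (p q : vertex X) :
  bridge b -> ends b = [set p; q] ->
  laplacian_map (bridge_side b p) = point p - point q.
Proof.
move=> bb bpq; have [[p0 q0] /= pq0] := edge_orientation X.
(* The given orientation of b need not agree with the chosen one. *)
pose p1 e := if e == b then p else p0 e.
pose q1 e := if e == b then q else q0 e.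
rewrite (@laplacian_map_edges _ p1 q1) => [|e]; last first.
  by rewrite /p1 /q1; case: eqP => [->|].
rewrite (bigD1 b) //= /p1 /q1 eqxx bridge_side_diff // big1 ?addr0 // => e eb.
by rewrite (negPf eb) (bridge_side_ends _ eb (pq0 e)) subrr mulr0z.
Qed.

Lemma point_bridge_connected (X : graph) (x y : vertex X) :
  connect (adj (@ends X) (bridges X)) x y ->
  point x - point y \in @im_laplacian X.
Proof.
case/connectP=> s; elim: s x => [|z s IH] x /=.
  by move=> _ ->; rewrite subrr rpred0.
case/andP=> /exists_inP[b bB /eqP bxz] zs ey.
rewrite -(subrK (point z) (point x)) -addrA rpredD ?IH //.
apply/asboolP; exists (bridge_side b x).
by rewrite (laplacian_bridge_side _ bxz) //; rewrite inE in bB.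
Qed.

(** * Pushing divisors forward along the contraction *)

Definition push (X : graph) (D : Div X) : Div (contract_bridges X) :=
  [ffun B => \sum_(v | contract_map v == B) D v].

Lemma push_is_zmod_morphism (X : graph) : zmod_morphism (@push X).
Proof.
move=> D D'; apply/ffunP=> B; rewrite !ffunE -sumrB.
by apply: eq_bigr => v _; rewrite !ffunE.
Qed.

HB.instance Definition _ (X : graph) :=
  GRing.isZmodMorphism.Build (Div X) (Div (contract_bridges X)) (@push X)
    (@push_is_zmod_morphism X).

Lemma push_point (X : graph) (v : vertex X) :
  push (point v) = point (contract_map v : vertex (contract_bridges X)).
Proof.
apply/ffunP=> B; rewrite !ffunE eq_sym.
have [<-|vB] := eqVneq (contract_map v) B.
  rewrite (bigD1 v) //= ffunE eqxx big1 ?addr0 // => w /andP[_ /negPf wv].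
  by rewrite ffunE wv.
rewrite big1 // => w /eqP wB; rewrite ffunE.
by case: eqP => // wv; rewrite -wB wv eqxx in vB.
Qed.

Lemma deg_push (X : graph) (D : Div X) : deg (push D) = deg D.
Proof.
rewrite /deg [RHS](partition_big (@contract_map X) predT) //=.
by apply: eq_bigr => B _; rewrite ffunE.
Qed.

Lemma effective_push (X : graph) (D : Div X) :
  effective D -> effective (push D).
Proof. by move=> eD B; rewrite ffunE; apply: sumr_ge0. Qed.

(** Put the whole value at a block on one chosen vertex of that block. *)
Lemma effective_lift (X : graph) (E : Div (contract_bridges X)) :
  exists D : Div X, push D = E /\ (effective E -> effective D).
Proof.
have /choice[s sK] := @contract_map_surj X.
exists [ffun v => E (contract_map v) *+ (v == s (contract_map v))]; split.
  apply/ffunP=> B; rewrite ffunE (bigD1 (s B)) /= -?sK // big1 => [|v].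
    by rewrite ffunE -sK eqxx addr0.
  by rewrite ffunE => /andP[/eqP -> /negPf ->].
by move=> eE v; rewrite ffunE mulrn_wge0.
Qed.

(** * Principal divisors and the contraction *)

(** Both sides are the sum over the non-bridges e of the same terms, with each
    end of e replaced by its block; on a bridge the pulled back function takes
    the same value at both ends. *)
Lemma push_laplacian_pullback (X : graph) (g : Div (contract_bridges X)) :
  push (laplacian_map [ffun v => g (contract_map v)]) = laplacian_map g.
Proof.
have [[p q] /= pqE] := edge_orientation X.
rewrite (laplacian_map_edges _ pqE) raddf_sum /=.
rewrite (@laplacian_map_edges (contract_bridges X)
  (fun e => contract_map (p (val e)))
  (fun e => contract_map (q (val e)))); last first.
  by move=> e; rewrite /= /contract_ends pqE imsetU1 imset_set1.
rewrite (bigID (@bridge X)) /= big1 ?add0r => [|e be].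
  rewrite (reindex_omap (val : contract_edge X -> edge X) insub) /=; last first.
    by move=> e nbe; rewrite insubT.
  apply: eq_big => [e|e _]; first by rewrite valK eqxx (valP e).
  by rewrite raddfMz (raddfB (@push X)) /= !push_point !ffunE.
have /contract_mapP pq : connect (adj (@ends X) (bridges X)) (p e) (q e).
  by apply/connect1/exists_inP; exists e; rewrite ?inE // pqE.
by rewrite !ffunE pq subrr mulr0z raddf0.
Qed.

(** Modulo the functions [bridge_side b (p b)], whose Laplacians [p b - q b] are
    killed by [push], every function is constant on the blocks, that is, pulled
    back from the contraction. *)
Lemma push_laplacian (X : graph) (f : Div X) :
  push (laplacian_map f) \in @im_laplacian (contract_bridges X).
Proof.
have [[p q] /= pqE] := edge_orientation X.
pose f0 : Div X :=
  \sum_(b | bridge b) bridge_side b (p b) *~ (f (p b) - f (q b)).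
(* The side of another bridge does not separate p b from q b. *)
have f0E b : bridge b -> f0 (p b) - f0 (q b) = f (p b) - f (q b).
  move=> bb; rewrite /f0 !sum_ffunE -sumrB (bigD1 b) //= big1 ?addr0.
    by rewrite !ffunMzE -mulrzBl bridge_side_diff // intz.
  move=> c /andP[_ cb]; rewrite !ffunMzE -mulrzBl.
  by rewrite (@bridge_side_ends _ c b _ _ (q b)) // 1?eq_sym // subrr mul0rz.
have pf0 : push (laplacian_map f0) = 0.
  rewrite /f0 !raddf_sum big1 //= => b bb.
  rewrite !raddfMz /= (laplacian_bridge_side bb (pqE b)).
  rewrite (raddfB (@push X)) /= !push_point.
  suff -> : contract_map (p b) = contract_map (q b) by rewrite subrr mul0rz.
  by apply/contract_mapP/connect1/exists_inP; exists b; rewrite ?inE // pqE.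
have ff0 x y : connect (adj (@ends X) (bridges X)) x y -> (f - f0) x = (f - f0) y.
  case/connectP=> s; elim: s x => [|z s IH] x /=; first by move=> _ ->.
  case/andP=> /exists_inP[b]; rewrite inE => /f0E f0b /eqP bxz zs ey.
  rewrite -(IH z) // !ffunE; move: bxz; rewrite pqE => bxz.
  have Epq : f (p b) - f0 (p b) = f (q b) - f0 (q b).
    by apply/eqP; rewrite subr_eq -addrA [- _ + _]addrC f0b addrC subrK.
  have : x \in [set p b; q b] by rewrite bxz !inE eqxx.
  have : z \in [set p b; q b] by rewrite bxz !inE eqxx orbT.
  by rewrite !inE => /orP[] /eqP -> /orP[] /eqP ->; rewrite ?Epq.
have /choice[s sK] := @contract_map_surj X.
apply/asboolP; exists [ffun B => (f - f0) (s B)].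
rewrite -push_laplacian_pullback -[LHS]subr0 -pf0 -!raddfB /=.
congr (push (laplacian_map _)); apply/ffunP=> v; rewrite !ffunE.
have := ff0 v (s (contract_map v)); rewrite !ffunE; apply.
by apply/contract_mapP; rewrite -sK.
Qed.

(** Moving each vertex to the representative of its block changes D by a
    principal divisor and turns it into a combination of the representatives
    with coefficients [push D], that is, into 0. *)
Lemma push_eq0 (X : graph) (D : Div X) : push D = 0 -> D \in @im_laplacian X.
Proof.
move=> pD0; have /choice[s sK] := @contract_map_surj X.
have D0 : \sum_v point (s (contract_map v)) *~ D v = 0 :> Div X.
  rewrite (partition_big (@contract_map X) predT) //= big1 // => B _.
  rewrite (eq_bigr (fun v => point (s B) *~ D v)) => [|v /eqP -> //].
  rewrite -mulrz_sumr; have /ffunP/(_ B) := pD0.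
  by rewrite !ffunE => ->; rewrite mulr0z.
have -> : D = \sum_v (point v - point (s (contract_map v))) *~ D v.
  by under eq_bigr do rewrite mulrzBl; rewrite sumrB D0 subr0 -sum_point.
rewrite rpred_sum // => v _; rewrite rpredMz // point_bridge_connected //.
by apply/contract_mapP; rewrite -sK.
Qed.

Lemma push_im_laplacian (X : graph) (D : Div X) :
  (push D \in @im_laplacian (contract_bridges X)) = (D \in @im_laplacian X).
Proof.
apply/idP/idP => [/asboolP[g gE]|/asboolP[f ->]]; last exact: push_laplacian.
rewrite -(subrK (laplacian_map [ffun v => g (contract_map v)]) D) rpredD //.
  by apply: push_eq0; rewrite raddfB /= push_laplacian_pullback gE subrr.
by apply/asboolP; eexists.
Qed.

Lemma push_equiv (X : graph) (D D' : Div X) :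
  div_equiv (push D) (push D') <-> div_equiv D D'.
Proof.
have im Y (C C' : Div Y) : div_equiv C C' <-> C - C' \in @im_laplacian Y.
  by split=> [/div_equivP ?|/asboolP ?]; [apply/asboolP | apply/div_equivP].
by rewrite !im -raddfB push_im_laplacian.
Qed.

(** * Invariance of h and of the zeta function *)

(** An effective divisor equivalent to [push D] lifts to an effective divisor,
    and its lift is equivalent to D because [push] reflects equivalence. *)
Lemma linear_system_push (X : graph) (D : Div X) :
  linear_system (push D) = set0%classic <-> linear_system D = set0%classic.
Proof.
rewrite -!subset0; split=> sub D' [eD' /= eqD'].
  by apply: (sub (push D')); split; [apply: effective_push | apply/push_equiv].
have [C [CD' eC]] := effective_lift D'; apply: (sub C).
by split; [apply: eC | apply/push_equiv; rewrite CD'].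
Qed.

Lemma rr_h_push (X : graph) (D : Div X) : rr_h (push D) = rr_h D.
Proof.
have E : kills (push D) =1 kills D.
  move=> k; apply: asbool_equiv_eq; split=> -[E [eE dE lE]].
    have [C [CE eC]] := effective_lift E; exists C.
    split; [exact: eC | by rewrite -deg_push CE |].
    by apply/linear_system_push; rewrite raddfB /= CE.
  exists (push E).
  split; [exact: effective_push | by rewrite deg_push |].
  by rewrite -raddfB; apply/linear_system_push.
rewrite /rr_h; case: ex_minnP => m km mm; case: ex_minnP => n kn nn.
by apply/eqP; rewrite eqn_leq mm ?E //= nn -?E.
Qed.

Theorem proposition3p5 (X : graph) : zeta X = zeta (contract_bridges X).
Proof.
apply/funext=> n; rewrite /zeta.
pose phi (c : Pic X) : Pic (contract_bridges X) :=
    \pi_(Pic (contract_bridges X)) (push (repr c)).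
rewrite (reindex_fsbig phi [set c : Pic X | pic_deg c = n%:Z]%classic).
  by apply: eq_fsbigr => c _; rewrite /phi pic_hE rr_h_push.
split=> [c /= <-|c c' _ _|c' /= <-].
- by rewrite /phi pic_degE deg_push.
- by rewrite /phi => /push_equiv; rewrite /div_equiv !reprK.
have [C [CE _]] := effective_lift (repr c').
exists (\pi_(Pic X) C).
  by rewrite /= pic_degE -deg_push CE.
rewrite /phi -[RHS]reprK -CE; apply/push_equiv.
by rewrite /div_equiv reprK.
Qed.
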